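(* Let $\Theta\subseteq\mathbb{R}$ be an interval and let $g:\Theta\to\mathbb{R}$ be a function whose second derivative $g''$ exists, such that the equation $g(\theta)=0$, $\theta\in\Theta$, has a unique root $\theta^*$, with $g(\theta)>0$ for all $\theta<\theta^*$ and $g(\theta)<0$ for all $\theta>\theta^*$ ($\theta\in\Theta$). Let $b_{21},b_{22}$ be two constants with $$b_{21}\le g''(\theta)\le b_{22}\qquad\text{for all }\theta\in\Theta,$$ and let, for $\theta,\theta^{(t)}\in\Theta$, $$b_2(\theta|\theta^{(t)})=b_{22}\cdot I(\theta\le\theta^{(t)})+b_{21}\cdot I(\theta>\theta^{(t)}),$$ $$U(\theta|\theta^{(t)})=g(\theta^{(t)})+(\theta-\theta^{(t)})g'(\theta^{(t)})+\frac{b_2(\theta|\theta^{(t)})}{2}(\theta-\theta^{(t)})^2.$$ Then the US iteration $$\theta^{(t+1)}=h(\theta^{(t)}),\qquad h(\theta^{(t)}):=\text{the solution in }\theta\in\Theta\text{ of }U(\theta|\theta^{(t)})=0,$$ has a quadratic convergence rate given by $$\lim_{t\to\infty}\frac{|\theta^{(t+1)}-\theta^*|}{|\theta^{(t)}-\theta^*|^2}=\frac{|h''(\theta^* )|}{2}=\left|\frac{b_{22}-g''(\theta^* )}{2g'(\theta^* )}\right|\in(0,\infty).$$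
   Context: $I(\cdot)$ denotes the indicator function. The constants $b_{21},b_{22}$ are called the second-derivative lower-upper bound (SLUB) constants. The iteration starts from an initial value $\theta^{(0)}\in\Theta$.
   Formalization: Assumes g'(θ* )≠0, θ⁰≠θ*. The b22 formula is for θ⁰>θ* with b22≠g''(θ* ); for θ⁰<θ*, b21 replaces b22 (b21≠g''(θ* )). h''(θ* ) is one-sided, on the iterates' side: equality holds if it exists, and it exists if g'' is continuous at θ* from that side. *)

(* Defs.v *)
From Stdlib Require Export Reals.
Open Scope R_scope.

Definition is_interval (D : R -> Prop) : Prop :=
  forall x y z, D x -> D z -> x <= y <= z -> D y.

Definition indicator {P Q : Prop} (d : {P} + {Q}) : R := if d then 1 else 0.

(* Derivatives of a function on [Theta] are taken relative to [Theta] ([D_in]):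
   two-sided at interior points, one-sided at an endpoint belonging to [Theta]. *)
Definition derivative_on (Theta : R -> Prop) (f f' : R -> R) : Prop :=
  forall x, Theta x -> D_in f f' Theta x.

Definition b2 (b21 b22 theta theta_t : R) : R :=
  b22 * indicator (Rle_dec theta theta_t) + b21 * indicator (Rgt_dec theta theta_t).

Definition U (g g' : R -> R) (b21 b22 theta theta_t : R) : R :=
  g theta_t + (theta - theta_t) * g' theta_t
  + b2 b21 b22 theta theta_t / 2 * (theta - theta_t) ^ 2.

Definition US_map (Theta : R -> Prop) (g g' : R -> R) (b21 b22 : R) (h : R -> R) : Prop :=
  forall x, Theta x -> Theta (h x) /\ U g g' b21 b22 (h x) x = 0.

(* [f], as a function on [D], is differentiable near [x] and its derivative has
   derivative [l] at [x]. *)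
Definition second_derivative_at (D : R -> Prop) (f : R -> R) (x l : R) : Prop :=
  exists (f' : R -> R) (delta : R), 0 < delta /\
    (forall y, D y -> Rabs (y - x) < delta -> D_in f f' D y) /\
    D_in f' (fun _ => l) D x.

(* The points of [Theta] on either side of [c].  [b2] switches from [b21] to [b22]
   at [theta = theta_t], so the iteration map is in general not twice
   differentiable at the root in the two-sided sense: its second derivative there
   is taken relative to the side on which the iterates lie. *)
Definition right_part (Theta : R -> Prop) (c x : R) : Prop := Theta x /\ c <= x.
Definition left_part (Theta : R -> Prop) (c x : R) : Prop := Theta x /\ x <= c.

Definition quadratic_rate (u : nat -> R) (l C : R) : Prop :=
  Un_cv u l /\
  Un_cv (fun t => Rabs (u (S t) - l) / Rabs (u t - l) ^ 2) C /\
  0 < C.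

(* Main.v *)
Require Import Defs.
From Stdlib Require Import Reals Lra.
Open Scope R_scope.

(** To the right of the root the quadratic [U] majorizes [g], and
    [U(y|x) - g(y)] is nonincreasing for [y <= x]; hence the only root [h x] of [U]
    lies in [[c, x]], it exceeds [c] as soon as [b22 <> g'' c], and the iterates
    decrease to a zero of [g].  Writing [u = h x - x] and [d = x - c], the equation
    [g x + u (g' x + b22 u / 2) = 0] gives [u / d -> -1], and then, with the second
    order expansion of [g] at [c],
    [(h x - c) / d^2 -> - (b22 - g'' c) / (2 g' c)].  Differencing the same equation
    gives [h'(x) = u (b22 - g'' x) / (g' x + b22 u)] near [c].  The left side
    reduces to the right one by [t |-> - t]. *)

(** * Limits and derivatives relative to a set *)

Lemma limit1_sub_ext (f f' : R -> R) (D D' : R -> Prop) (l x0 : R) :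
  (forall x, D' x -> D x /\ f x = f' x) ->
  limit1_in f D l x0 -> limit1_in f' D' l x0.
Proof.
intros H Hl eps he; destruct (Hl eps he) as [alp [ha Ha]].
exists alp; split; [exact ha|]; intros x [Dx hx].
destruct (H x Dx) as [Dx' <-]; now apply Ha.
Qed.

Lemma limit1_near (f : R -> R) (D : R -> Prop) (l x0 delta : R) :
  0 < delta ->
  limit1_in f (fun x => D x /\ Rabs (x - x0) < delta) l x0 -> limit1_in f D l x0.
Proof.
intros hd Hl eps he; destruct (Hl eps he) as [alp [ha Ha]].
exists (Rmin alp delta); split; [now apply Rmin_pos|]; intros x [Dx hx].
simpl in *; unfold Rdist in *.
apply Ha; repeat split; trivial; eapply Rlt_le_trans; try exact hx.
apply Rmin_r. apply Rmin_l.
Qed.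

Lemma limit1_squeeze (f k : R -> R) (D : R -> Prop) (l x0 : R) :
  (forall x, D x -> Rabs (f x - l) <= k x) ->
  limit1_in k D 0 x0 -> limit1_in f D l x0.
Proof.
intros H Hk eps he; destruct (Hk eps he) as [alp [ha Ha]].
exists alp; split; [exact ha|]; intros x Hx; specialize (Ha x Hx).
simpl in *; unfold Rdist in *; rewrite Rminus_0_r in Ha.
apply Rle_lt_trans with (k x); [now apply H|].
now apply Rle_lt_trans with (2 := Ha); apply RRle_abs.
Qed.

Lemma limit1_const (D : R -> Prop) (a x0 : R) : limit1_in (fun _ => a) D a x0.
Proof. exact (limit_free (fun _ => a) D x0 x0). Qed.

Lemma limit1_eq (f : R -> R) (D : R -> Prop) (l l' x0 : R) :
  l = l' -> limit1_in f D l x0 -> limit1_in f D l' x0.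
Proof. now intros ->. Qed.

Lemma limit1_seq (f : R -> R) (D : R -> Prop) (l x0 : R) (u : nat -> R) :
  limit1_in f D l x0 -> (forall n, D (u n)) -> Un_cv u x0 ->
  Un_cv (fun n => f (u n)) l.
Proof.
intros Hf Du Hu eps he; destruct (Hf eps he) as [alp [ha Ha]].
destruct (Hu alp ha) as [N HN]; exists N; intros n hn.
apply (Ha (u n)); split; [apply Du | now apply HN].
Qed.

Lemma limit1_opp_arg (f : R -> R) (D : R -> Prop) (l x0 : R) :
  limit1_in f D l (- x0) ->
  limit1_in (fun t => f (- t)) (fun t => D (- t)) l x0.
Proof.
intros Hf eps he; destruct (Hf eps he) as [alp [ha Ha]].
exists alp; split; [exact ha|]; intros x [Dx hx]; apply (Ha (- x)); split; trivial.
simpl in *; unfold Rdist in *.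
now replace (- x - - x0) with (- (x - x0)) by ring; rewrite Rabs_Ropp.
Qed.

Lemma D_in_incl (f f' : R -> R) (D D' : R -> Prop) (x : R) :
  (forall y, D' y -> D y) -> D_in f f' D x -> D_in f f' D' x.
Proof.
intros H; apply limit1_sub_ext; intros y [Dy hy]; repeat split; auto.
Qed.

Lemma D_in_opp_arg (f f' : R -> R) (D : R -> Prop) (x : R) :
  D_in f f' D (- x) ->
  D_in (fun t => - f (- t)) (fun t => f' (- t)) (fun t => D (- t)) x.
Proof.
intros H; apply limit1_opp_arg in H; revert H; apply limit1_sub_ext.
intros y [Dy hy]; repeat split; trivial; [lra|].
field; lra.
Qed.

Lemma D_in_derivable_pt_lim (f f' : R -> R) (D : R -> Prop) (a b x : R) :
  a < x < b -> (forall y, a <= y <= b -> D y) -> D_in f f' D x ->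
  derivable_pt_lim f x (f' x).
Proof.
intros hx HD Hf eps he; destruct (Hf eps he) as [alp [ha Ha]].
assert (hd : 0 < Rmin alp (Rmin (x - a) (b - x))) by (repeat apply Rmin_pos; lra).
exists (mkposreal _ hd); intros h hh0 hh; simpl in hh.
assert (h1 := Rmin_l alp (Rmin (x - a) (b - x))).
assert (h2 := Rmin_r alp (Rmin (x - a) (b - x))).
assert (h3 := Rmin_l (x - a) (b - x)); assert (h4 := Rmin_r (x - a) (b - x)).
assert (h5 := Rabs_def2 _ _ hh).
specialize (Ha (x + h)); simpl in Ha; unfold Rdist in Ha.
replace (x + h - x) with h in Ha by ring.
apply Ha; repeat split; [apply HD; lra | lra | lra].
Qed.

(** Composing with the projection [Rmax a (Rmin b x)] extends a function from [[a, b]] to the line.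
    The projection fixes the segment and does not increase distances to its points, so continuity
    survives. *)
Lemma clamp_between (a b x : R) : a <= b -> a <= Rmax a (Rmin b x) <= b.
Proof.
intros hab; split; [apply Rmax_l|].
apply Rmax_lub; [exact hab | apply Rmin_l].
Qed.

Lemma clamp_id (a b x : R) : a <= x <= b -> Rmax a (Rmin b x) = x.
Proof. intros h; rewrite Rmin_right, Rmax_right; lra. Qed.

Lemma clamp_dist (a b c x : R) :
  a <= c <= b -> Rabs (Rmax a (Rmin b x) - c) <= Rabs (x - c).
Proof.
intros hc; destruct (Rle_dec a x) as [hax|hax]; [destruct (Rle_dec x b) as [hxb|hxb]|].
- rewrite clamp_id; lra.
- rewrite Rmin_left, Rmax_right by lra; rewrite !Rabs_pos_eq; lra.
- rewrite Rmin_right, Rmax_left by lra; rewrite !Rabs_left1; lra.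
Qed.

(** * Mean value theorem and second order expansion for relative derivatives *)

Lemma D_in_mvt (f f' : R -> R) (D : R -> Prop) (a b : R) :
  a < b -> (forall x, a <= x <= b -> D x /\ D_in f f' D x) ->
  exists c, a < c < b /\ f b - f a = f' c * (b - a).
Proof.
intros hab H.
(* [D_in] is one-sided at the ends of [[a, b]], whereas [MVT] wants two-sided
   continuity there: hence the constant extension of [f] beyond [a] and [b]. *)
set (F := fun t => f (Rmax a (Rmin b t))).
assert (hF : forall c, a < c < b -> derivable_pt_lim F c (f' c)).
{ intros c hc; apply (D_in_derivable_pt_lim F f' (fun x => a <= x <= b) a b c hc).
  - trivial.
  - destruct (H c ltac:(lra)) as [_ Hc]; revert Hc; apply limit1_sub_ext.
    intros y [hy hyc]; repeat split; trivial; [now apply H|].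
    unfold F; now rewrite !clamp_id by lra. }
assert (hC : forall c, a <= c <= b -> continuity_pt F c).
{ intros c hc eps he.
  destruct (H c hc) as [_ Hc]; apply cont_deriv in Hc.
  destruct (Hc eps he) as [alp [ha Ha]]; exists alp; split; [exact ha|].
  intros x [_ hx]; simpl in *; unfold F; rewrite (clamp_id a b c hc).
  assert (h1 := clamp_between a b x ltac:(lra)).
  destruct (Req_dec c (Rmax a (Rmin b x))) as [<-|hne].
  - now unfold Rdist; rewrite Rminus_diag, Rabs_R0.
  - apply Ha; repeat split; trivial; [now apply H|].
    unfold Rdist in *; apply Rle_lt_trans with (2 := hx).
    now apply clamp_dist. }
assert (pr1 : forall c, a < c < b -> derivable_pt F c).
{ intros c hc; exists (f' c); now apply hF. }
assert (pr2 : forall c, a < c < b -> derivable_pt id c).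
{ intros c _; apply derivable_pt_id. }
destruct (MVT F id a b pr1 pr2 hab hC) as [c [hc E]].
{ intros c _; apply derivable_continuous_pt, derivable_pt_id. }
exists c; split; [exact hc|].
rewrite (derive_pt_eq_0 _ _ _ (pr1 c hc) (hF c hc)) in E.
rewrite (derive_pt_eq_0 _ _ _ (pr2 c hc) (derivable_pt_lim_id c)) in E.
unfold F, id in E; rewrite !clamp_id in E by lra; lra.
Qed.

Lemma D_in_quadratic (D : R -> Prop) (p q r a y : R) :
  D_in (fun x => p + q * (x - a) + r * (x - a) ^ 2) (fun x => q + 2 * r * (x - a)) D y.
Proof.
(* The difference quotient between [x] and [y] is exactly [q + r * ((x - a) + (y - a))]. *)
assert (H : limit1_in (fun x => q + r * ((x - a) + (y - a))) (D_x D y)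
              (q + r * ((y - a) + (y - a))) y).
{ apply limit_plus; [apply limit1_const|].
  apply limit_mul; [apply limit1_const|].
  apply limit_plus; [|apply limit1_const].
  apply limit_minus; [apply lim_x | apply limit1_const]. }
unfold D_in; replace (q + 2 * r * (y - a)) with (q + r * ((y - a) + (y - a))) by ring.
revert H; apply limit1_sub_ext; intros x [Dx hx]; repeat split; trivial.
field; lra.
Qed.

(* For [p = f - (second order Taylor polynomial)], the mean value theorem gives
   [p x = (x - c) p' y] with [y] between [c] and [x], and [p' y = o(y - c)]. *)
Lemma peano2 (D : R -> Prop) (f f' : R -> R) (c l delta : R) :
  is_interval D -> D c -> (forall x, D x -> c <= x) -> 0 < delta ->
  (forall y, D y -> Rabs (y - c) < delta -> D_in f f' D y) ->
  D_in f' (fun _ => l) D c ->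
  limit1_in (fun x => (f x - f c - f' c * (x - c)) / (x - c) ^ 2) (D_x D c) (l / 2) c.
Proof.
intros hD Dc hge hd Hf Hf' eps he.
destruct (Hf' eps he) as [alp [ha Ha]].
exists (Rmin alp delta); split; [now apply Rmin_pos|].
intros x [[Dx hx] hxd]; simpl in *; unfold Rdist in *.
assert (h1 := Rmin_l alp delta); assert (h2 := Rmin_r alp delta).
assert (hcx : c < x) by (specialize (hge x Dx); lra).
rewrite Rabs_pos_eq in hxd by lra.
set (p := fun y => f y - (f c + f' c * (y - c) + l / 2 * (y - c) ^ 2)).
set (p' := fun y => f' y - (f' c + 2 * (l / 2) * (y - c))).
destruct (D_in_mvt p p' D c x hcx) as [y [hy E]].
{ intros y hy; assert (Dy : D y) by (now apply (hD c y x)); split; trivial.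
  assert (Hy := Hf y Dy ltac:(rewrite Rabs_pos_eq; lra)).
  exact (Dminus D f' (fun z => f' c + 2 * (l / 2) * (z - c)) f _ y Hy
           (D_in_quadratic D (f c) (f' c) (l / 2) c y)). }
assert (Dy : D y) by (apply (hD c y x); trivial; lra).
specialize (Ha y); rewrite Rabs_pos_eq with (x := y - c) in Ha by lra.
assert (hs : D_x D c y /\ y - c < alp) by (repeat split; trivial; lra).
specialize (Ha hs).
assert (E1 : p' y = ((f' y - f' c) / (y - c) - l) * (y - c)) by (unfold p'; field; lra).
assert (E2 : (f x - f c - f' c * (x - c)) / (x - c) ^ 2 - l / 2
  = ((f' y - f' c) / (y - c) - l) * ((y - c) / (x - c))).
{ apply Rmult_eq_reg_r with ((x - c) ^ 2); [|apply pow_nonzero; lra].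
  transitivity (p x - p c); [unfold p; field; lra|].
  rewrite E, E1; field; lra. }
change (Rabs ((f x - f c - f' c * (x - c)) / (x - c) ^ 2 - l / 2) < eps).
rewrite E2, Rabs_mult.
assert (h3 : 0 < (y - c) / (x - c) <= 1).
{ split; [apply Rdiv_lt_0_compat; lra|].
  apply Rmult_le_reg_r with (x - c); [lra|].
  unfold Rdiv; rewrite Rmult_assoc, Rinv_l by lra; lra. }
rewrite (Rabs_pos_eq ((y - c) / (x - c))) by lra.
assert (h4 := Rabs_pos ((f' y - f' c) / (y - c) - l)).
nra.
Qed.

(** Taking [f' c] itself as tolerance, all difference quotients close enough to [c] are positive;
    only the derivative at [c] enters. *)
Lemma D_in_pos_increases (D : R -> Prop) (f f' : R -> R) (c x : R) :
  is_interval D -> D c -> D x -> c < x -> D_in f f' D c -> 0 < f' c ->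
  exists s, c < s < x /\ f c < f s.
Proof.
intros hD Dc Dx hcx Hf hpos; destruct (Hf _ hpos) as [alp [ha Ha]].
assert (hm : 0 < Rmin alp (x - c)) by (apply Rmin_pos; lra).
assert (h1 := Rmin_l alp (x - c)); assert (h2 := Rmin_r alp (x - c)).
set (s := c + Rmin alp (x - c) / 2).
assert (hs : c < s < x) by (unfold s; lra).
exists s; split; [exact hs|].
assert (hb : D_x D c s /\ Rdist s c < alp).
{ repeat split; [apply (hD c s x); trivial; lra | lra |].
  unfold Rdist; rewrite Rabs_pos_eq; unfold s; lra. }
specialize (Ha s hb); simpl in Ha; unfold Rdist in Ha.
apply Rabs_def2 in Ha.
assert (h3 : 0 < (f s - f c) / (s - c) * (s - c)) by (apply Rmult_lt_0_compat; lra).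
replace ((f s - f c) / (s - c) * (s - c)) with (f s - f c) in h3 by (field; lra); lra.
Qed.

(** * A single branch of [U], with frozen curvature [b], as a majorant of [g] *)

Definition quad (g g' : R -> R) (b y x : R) : R :=
  g x + (y - x) * g' x + b / 2 * (y - x) ^ 2.

Lemma D_in_quad (D : R -> Prop) (g g' : R -> R) (b y x : R) :
  D_in (fun y => quad g g' b y x) (fun y => g' x + b * (y - x)) D y.
Proof.
assert (H := D_in_quadratic D (g x) (g' x) (b / 2) x y).
unfold D_in in *; replace (g' x + b * (y - x)) with (g' x + 2 * (b / 2) * (y - x)) by field.
revert H; apply limit1_sub_ext; intros z [Dz hz]; repeat split; trivial.
unfold quad; field; lra.
Qed.

(** The left side is the derivative of [quad - g] at [y]. By the mean value theorem it equals
    [(b - g'' t) * (y - x)] for some [t] in between. *)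
Lemma slope_majorized (D : R -> Prop) (g' g'' : R -> R) (b y x : R) :
  is_interval D -> derivative_on D g' g'' -> (forall t, D t -> g'' t <= b) ->
  D y -> D x -> y <= x -> g' x + b * (y - x) - g' y <= 0.
Proof.
intros hD Hg' hb Dy Dx hyx; destruct (Req_dec y x) as [->|hne]; [lra|].
destruct (D_in_mvt g' g'' D y x) as [t [ht E]]; [lra| |].
- intros t ht; assert (D t) by (now apply (hD y t x)); split; [|apply Hg']; trivial.
- assert (Dt : D t) by (apply (hD y t x); trivial; lra).
  specialize (hb t Dt); nra.
Qed.

Lemma quad_sub_decreasing (D : R -> Prop) (g g' g'' : R -> R) (b y z x : R) :
  is_interval D -> derivative_on D g g' -> derivative_on D g' g'' ->
  (forall t, D t -> g'' t <= b) ->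
  D y -> D x -> y <= z <= x ->
  quad g g' b z x - g z <= quad g g' b y x - g y.
Proof.
intros hD Hg Hg' hb Dy Dx h; destruct (Req_dec y z) as [->|hne]; [lra|].
destruct (D_in_mvt (fun t => quad g g' b t x - g t)
            (fun t => g' x + b * (t - x) - g' t) D y z) as [t [ht E]]; [lra| |].
- intros t ht; assert (Dt : D t) by (apply (hD y t x); trivial; lra).
  split; [exact Dt|].
  apply (Dminus D (fun t => g' x + b * (t - x)) g' (fun t => quad g g' b t x) g t).
  + apply D_in_quad.
  + now apply Hg.
- assert (Dt : D t) by (apply (hD y t x); trivial; lra).
  assert (hs := slope_majorized D g' g'' b t x hD Hg' hb Dt Dx ltac:(lra)).
  cbv beta in E; nra.
Qed.

Lemma quad_diag (g g' : R -> R) (b x : R) : quad g g' b x x = g x.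
Proof. unfold quad; ring. Qed.

Lemma quad_majorizes (D : R -> Prop) (g g' g'' : R -> R) (b y x : R) :
  is_interval D -> derivative_on D g g' -> derivative_on D g' g'' ->
  (forall t, D t -> g'' t <= b) ->
  D y -> D x -> y <= x -> g y <= quad g g' b y x.
Proof.
intros hD Hg Hg' hb Dy Dx h.
assert (H := quad_sub_decreasing D g g' g'' b y x x hD Hg Hg' hb Dy Dx ltac:(lra)).
rewrite quad_diag in H; lra.
Qed.

(* The part of the problem to the right of the root, where the iterates started
   there stay and where only the upper bound on [g''] matters. *)
Record right_problem (D : R -> Prop) (g g' g'' : R -> R) (c b : R) : Prop := {
  rp_interval : is_interval D;
  rp_root_in : D c;
  rp_ge : forall x, D x -> c <= x;
  rp_g : derivative_on D g g';
  rp_g' : derivative_on D g' g'';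
  rp_root : g c = 0;
  rp_neg : forall x, D x -> c < x -> g x < 0;
  rp_upper : forall x, D x -> g'' x <= b;
  rp_simple : g' c <> 0 }.

Arguments rp_interval {_ _ _ _ _ _} _.
Arguments rp_root_in {_ _ _ _ _ _} _.
Arguments rp_ge {_ _ _ _ _ _} _.
Arguments rp_g {_ _ _ _ _ _} _.
Arguments rp_g' {_ _ _ _ _ _} _.
Arguments rp_root {_ _ _ _ _ _} _.
Arguments rp_neg {_ _ _ _ _ _} _.
Arguments rp_upper {_ _ _ _ _ _} _.
Arguments rp_simple {_ _ _ _ _ _} _.

(** * The one-sided problem: roots of the quadratic to the right of [c] *)

Section RightProblem.

Context (D : R -> Prop) (g g' g'' : R -> R) (c b : R).
Context (rp : right_problem D g g' g'' c b).

Lemma rp_between (y x : R) : D x -> c <= y <= x -> D y.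
Proof.
intros Dx hy; exact (rp_interval rp c y x (rp_root_in rp) Dx hy).
Qed.

Lemma rp_adherent (x : R) : D x -> c < x -> adhDa (D_x D c) c.
Proof.
intros Dx hx alp ha.
assert (hm : 0 < Rmin alp (x - c)) by (apply Rmin_pos; lra).
assert (h1 := Rmin_l alp (x - c)); assert (h2 := Rmin_r alp (x - c)).
exists (c + Rmin alp (x - c) / 2); repeat split.
- apply (rp_between _ x Dx); lra.
- lra.
- unfold Rdist; rewrite Rabs_pos_eq; lra.
Qed.

(** A positive slope would make [g] exceed [g c = 0] just to the right of [c]. The point [x] ensures
    that [D] has points there. *)
Lemma rp_slope (x : R) : D x -> c < x -> g' c < 0.
Proof.
intros Dx hx; destruct rp.
destruct (Rtotal_order (g' c) 0) as [h|[h|h]]; [exact h | contradiction |].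
destruct (D_in_pos_increases D g g' c x) as [s [hs Hs]]; auto.
assert (Ds : D s) by (apply (rp_between s x Dx); lra).
assert (h1 := rp_neg0 s Ds ltac:(lra)); lra.
Qed.

(** Majorization is strict at the root, so an iterate cannot land on it. Let [p = quad - g], so that
    [p >= 0] and [p' <= 0]. As [p'] has derivative [b - g'' c > 0] at [c], it rises strictly to a
    value that is still at most 0, whence [p' c < 0]. Then [p] falls strictly from [p c] to a value
    that is still at least 0, whence [p c > 0]; and [g c = 0]. *)
Lemma rp_quad_root_pos (x : R) :
  D x -> c < x -> b <> g'' c -> 0 < quad g g' b c x.
Proof.
intros Dx hx hne; destruct rp.
set (p := fun t => quad g g' b t x - g t).
set (p' := fun t => g' x + b * (t - x) - g' t).
assert (Hp : forall t, D t -> D_in p p' D t).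
{ intros t Dt; apply (Dminus D (fun t => g' x + b * (t - x)) g' (fun t => quad g g' b t x) g t).
  - apply D_in_quad.
  - now apply rp_g0. }
assert (Hp' : D_in p' (fun t => b - g'' t) D c).
{ apply (Dminus D (fun _ => b) g'' (fun t => g' x + b * (t - x)) g' c); [|now apply rp_g'0].
  assert (H := D_in_quadratic D (g' x) b 0 x c); unfold D_in in H |- *.
  replace (b + 2 * 0 * (c - x)) with b in H by ring.
  revert H; apply limit1_sub_ext; intros z hz; destruct hz as [Dz hz].
  repeat split; trivial; field; lra. }
assert (hb : g'' c < b) by (specialize (rp_upper0 c rp_root_in0); lra).
destruct (D_in_pos_increases D p' (fun t => b - g'' t) c x) as [s [hs Hs]]; auto; [lra|].
assert (Ds : D s) by (apply (rp_between s x Dx); lra).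
assert (h1 := slope_majorized D g' g'' b s x rp_interval0 rp_g'0 rp_upper0 Ds Dx ltac:(lra)).
fold (p' s) in h1.
destruct (D_in_pos_increases D (fun t => - p t) (fun t => - p' t) c x) as [r [hr Hr]];
  auto; [now apply Dopp, Hp | lra |].
assert (Dr : D r) by (apply (rp_between r x Dx); lra).
assert (h2 := quad_majorizes D g g' g'' b r x rp_interval0 rp_g0 rp_g'0 rp_upper0 Dr Dx ltac:(lra)).
unfold p in Hr; lra.
Qed.

Lemma rp_quad_unique_root (x : R) :
  D x -> exists y, c <= y <= x /\ quad g g' b y x = 0 /\
    forall z, c <= z <= x -> quad g g' b z x = 0 -> z = y.
Proof.
intros Dx; assert (hcx := rp_ge rp x Dx).
assert (hc := rp_root rp).
destruct (Req_dec c x) as [<-|hne].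
{ exists c; repeat split; try lra; [now rewrite quad_diag|].
  intros z hz _; lra. }
assert (hgx := rp_neg rp x Dx ltac:(lra)).
assert (Hmono := fun y z Dy => quad_sub_decreasing D g g' g'' b y z x
  (rp_interval rp) (rp_g rp) (rp_g' rp)
  (rp_upper rp) Dy Dx).
assert (Dc := rp_root_in rp).
assert (h0 : 0 <= quad g g' b c x).
{ assert (H := Hmono c x Dc ltac:(lra)); rewrite quad_diag in H; lra. }
assert (Hcont : continuity (fun y => quad g g' b y x)).
{ unfold quad; intros y; reg. }
(* The signs at the ends are opposite: [h0] at [c], and [quad x x = g x < 0] at [x]. *)
destruct (IVT_cor (fun y => quad g g' b y x) c x Hcont ltac:(lra)) as [y [hy Ey]].
{ cbv beta; rewrite (quad_diag g g' b x); nra. }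
(* Two roots [r < s] below [x] would force [b < 0] as [quad x x < 0], hence
   [quad c x < 0] unless [r = c]; but then [quad - g], being decreasing with
   value [0] at both [c] and [x], vanishes at [s], and so does [g]. *)
assert (Huniq : forall r s, c <= r -> r < s -> s <= x ->
  quad g g' b r x = 0 -> quad g g' b s x = 0 -> False).
{ intros r s hr hrs hs Er Es.
  assert (Hfac : forall t, quad g g' b t x = b / 2 * ((t - r) * (t - s))).
  (* Lagrange interpolation of the quadratic at the nodes [r] and [s], with exact remainder,
     multiplied by [s - r]. *)
  { intros t; assert (E0 : (s - r) * (quad g g' b t x - b / 2 * ((t - r) * (t - s)))
      = (s - t) * quad g g' b r x + (t - r) * quad g g' b s x) by (unfold quad; field).
    rewrite Er, Es in E0; nra. }
  assert (hsx : s <> x) by (intros ->; rewrite quad_diag in Es; lra).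
  assert (hbneg : b < 0).
  { assert (E0 := Hfac x); rewrite quad_diag in E0.
    assert (0 < (x - r) * (x - s)) by (apply Rmult_lt_0_compat; lra); nra. }
  assert (hrc : r = c).
  { rewrite Hfac in h0; destruct (Req_dec r c) as [h|h]; [exact h|].
    assert (0 < (r - c) * (s - c)) by (apply Rmult_lt_0_compat; lra); nra. }
  subst r.
  assert (Ds : D s) by (apply (rp_between s x Dx); lra).
  assert (h1 := Hmono c s Dc ltac:(lra)); assert (h2 := Hmono s x Ds ltac:(lra)).
  rewrite quad_diag in h2.
  assert (h3 := rp_neg rp s Ds ltac:(lra)); lra. }
exists y; repeat split; try lra; intros z hz Ez.
destruct (Rtotal_order z y) as [h|[h|h]]; [exfalso|exact h|exfalso].
- apply (Huniq z y); lra.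
- apply (Huniq y z); lra.
Qed.

(** * The iteration map at the root: limits of first and second order *)

Context (h : R -> R).
Context (h_root : forall x, D x -> c <= h x <= x /\ quad g g' b (h x) x = 0).

Lemma h_fixes_root : h c = c.
Proof. destruct (h_root c) as [H _]; [apply rp | lra]. Qed.

Lemma h_step_eq (x : R) : D x -> g x + (h x - x) * (g' x + b / 2 * (h x - x)) = 0.
Proof. intros Dx; destruct (h_root x Dx) as [_ E]; unfold quad in E; lra. Qed.

Lemma h_above_root (x : R) : D x -> c < x -> b <> g'' c -> c < h x < x.
Proof.
intros Dx hx hb; destruct (h_root x Dx) as [Hh E].
assert (h1 : h x <> c).
{ intros e; rewrite e in E; assert (H := rp_quad_root_pos x Dx hx hb); lra. }
assert (h2 : h x <> x).
{ intros e; rewrite e, quad_diag in E; assert (H := rp_neg rp x Dx hx); lra. }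
lra.
Qed.

Lemma h_step_lim0 : limit1_in (fun x => h x - x) (D_x D c) 0 c.
Proof.
apply limit1_squeeze with (fun x => x - c).
- intros x [Dx _]; destruct (h_root x Dx) as [Hh _].
  rewrite Rminus_0_r, Rabs_left1; lra.
- apply limit1_eq with (c - c); [ring|].
  apply limit_minus; [apply lim_x | apply limit1_const].
Qed.

(** The step is [- g x] divided by a denominator that tends to [g' c], while [g x / (x - c)] tends
    to [g' c] as well. *)
Lemma h_step_ratio : limit1_in (fun x => (h x - x) / (x - c)) (D_x D c) (-1) c.
Proof.
assert (Hc := rp_root_in rp).
assert (Hden : limit1_in (fun x => g' x + b / 2 * (h x - x)) (D_x D c) (g' c) c).
{ apply limit1_eq with (g' c + b / 2 * 0); [ring|].
  apply limit_plus.
  - exact (cont_deriv _ _ _ _ (rp_g' rp c Hc)).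
  - apply limit_mul; [apply limit1_const | apply h_step_lim0]. }
assert (H := limit_mul _ _ _ _ _ _ (rp_g rp c Hc)
  (limit_inv _ _ _ _ Hden (rp_simple rp))).
apply limit_Ropp in H.
apply limit1_eq with (l' := -1) in H;
  [|field; apply (rp_simple rp)].
revert H; apply limit1_sub_ext; intros x [Dx hx]; repeat split; trivial.
assert (hgt : c < x) by (assert (e := rp_ge rp x Dx); lra).
assert (hneg := rp_neg rp x Dx hgt).
assert (E := h_step_eq x Dx).
(* A vanishing denominator would force [g x = 0]. *)
assert (hd : g' x + b / 2 * (h x - x) <> 0) by (intros e; rewrite e in E; lra).
rewrite (rp_root rp).
replace (g x - 0) with (- ((h x - x) * (g' x + b / 2 * (h x - x)))) by lra.
revert hd; generalize (g' x + b / 2 * (h x - x)); intros d hd; field; split; [lra | exact hd].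
Qed.

(** Put [d = x - c], [r = (h x - x) / d], [A = (g x - g' c * d) / d^2] and [B = (g' x - g' c) / d].
    Dividing the step equation by [d^2] gives [A + r B + (b / 2) r^2 + (g' c / d) (1 + r) = 0],
    where [1 + r = (h x - c) / d]. The limits of [A], [B], [r] are [g'' c / 2], [g'' c], [-1]. *)
Lemma h_quadratic_ratio :
  limit1_in (fun x => (h x - c) / (x - c) ^ 2) (D_x D c)
    (- ((b - g'' c) / (2 * g' c))) c.
Proof.
assert (Hc := rp_root_in rp).
assert (hs := rp_simple rp).
assert (HA := peano2 D g g' c (g'' c) 1 (rp_interval rp) Hc
  (rp_ge rp) Rlt_0_1 (fun y Dy _ => rp_g rp y Dy)
  (rp_g' rp c Hc)).
assert (HB := rp_g' rp c Hc).
assert (Hr := h_step_ratio).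
assert (H := limit_mul _ _ _ _ _ _
  (limit_plus _ _ _ _ _ _
    (limit_plus _ _ _ _ _ _ HA (limit_mul _ _ _ _ _ _ Hr HB))
    (limit_mul _ _ _ _ _ _ (limit1_const _ (b / 2) _) (limit_mul _ _ _ _ _ _ Hr Hr)))
  (limit1_const _ (- / g' c) _)).
apply limit1_eq with (l' := - ((b - g'' c) / (2 * g' c))) in H; [|field; exact hs].
revert H; apply limit1_sub_ext; intros x [Dx hx]; repeat split; trivial.
assert (E := h_step_eq x Dx).
rewrite (rp_root rp).
replace (g x) with (- ((h x - x) * (g' x + b / 2 * (h x - x)))) by lra.
field; split; [lra | exact hs].
Qed.

Lemma h_derivative_root : limit1_in (fun x => (h x - h c) / (x - c)) (D_x D c) 0 c.
Proof.
assert (Hx : limit1_in (fun x => x - c) (D_x D c) (c - c) c)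
  by (apply limit_minus; [apply lim_x | apply limit1_const]).
assert (H := limit_mul _ _ _ _ _ _ h_quadratic_ratio Hx).
apply limit1_eq with (l' := 0) in H; [|ring].
revert H; apply limit1_sub_ext; intros x [Dx hx]; repeat split; trivial.
rewrite h_fixes_root; field; lra.
Qed.

(** Since [h' c = 0] and [h c = c], the second order expansion of [h] says that
    [(h x - c) / (x - c)^2] tends to [h2 / 2]. Uniqueness of limits concludes, [c] being an
    accumulation point of [D]. *)
Lemma h_second_derivative_value (x h2 : R) :
  D x -> c < x -> second_derivative_at D h c h2 ->
  h2 / 2 = - ((b - g'' c) / (2 * g' c)).
Proof.
intros Dx hx [h' [delta [hd [Hh' Hh2]]]].
assert (Dc := rp_root_in rp).
assert (Hadh := rp_adherent x Dx hx).
assert (E : h' c = 0).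
{ apply (single_limit _ _ _ _ _ Hadh) with (2 := h_derivative_root).
  apply Hh'; [exact Dc|]; now rewrite Rminus_diag, Rabs_R0. }
apply (single_limit _ _ _ _ _ Hadh) with (2 := h_quadratic_ratio).
assert (H := peano2 D h h' c h2 delta (rp_interval rp) Dc
  (rp_ge rp) hd Hh' Hh2).
revert H; apply limit1_sub_ext; intros y [Dy hy]; repeat split; trivial.
rewrite E, h_fixes_root; field; lra.
Qed.

(** * Differentiability of the iteration map near the root *)

Lemma rp_denominator_neg :
  g' c < 0 ->
  exists delta, 0 < delta /\ forall x v, D x -> Rabs (x - c) < delta -> Rabs v < delta ->
    g' x + b * v <= g' c / 2.
Proof.
intros hs; assert (Dc := rp_root_in rp).
assert (Hcont := cont_deriv _ _ _ _ (rp_g' rp c Dc)).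
(* Half of the margin [- g' c / 2] is spent on the continuity of [g'], half on [b * v]. The [+ 1]
   below guards against [b = 0]. *)
destruct (Hcont (- g' c / 4) ltac:(lra)) as [alp [ha Ha]].
assert (hb := Rabs_pos b).
assert (hk : 0 < - g' c / (4 * (Rabs b + 1))) by (apply Rdiv_lt_0_compat; lra).
exists (Rmin alp (- g' c / (4 * (Rabs b + 1)))); split; [now apply Rmin_pos|].
intros x v Dx hx hv.
assert (h1 := Rmin_l alp (- g' c / (4 * (Rabs b + 1)))).
assert (h2 := Rmin_r alp (- g' c / (4 * (Rabs b + 1)))).
assert (hgx : g' x <= g' c - g' c / 4).
{ destruct (Req_dec c x) as [<-|hne]; [lra|].
  assert (hin : D_x D c x /\ Rdist x c < alp) by (repeat split; trivial; unfold Rdist; lra).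
  specialize (Ha x hin); simpl in Ha; unfold Rdist in Ha; apply Rabs_def2 in Ha; lra. }
assert (hbv : b * v <= - g' c / 4).
{ apply Rle_trans with (1 := RRle_abs (b * v)); rewrite Rabs_mult.
  assert (hv2 := Rabs_pos v).
  apply Rle_trans with ((Rabs b + 1) * (- g' c / (4 * (Rabs b + 1)))).
  - apply Rmult_le_compat; lra.
  - right; field; lra. }
lra.
Qed.

(** Subtracting the step equations at [x] and [a] gives [(u x - u a) * den x = - num x * (x - a)]:
    the difference of squares puts the average of the two steps into [den]. The difference quotient
    of [h] is therefore [1 - num / den]. *)
Lemma h_derivative :
  g' c < 0 ->
  exists delta, 0 < delta /\ forall x, D x -> Rabs (x - c) < delta ->
    D_in h (fun x => (h x - x) * (b - g'' x) / (g' x + b * (h x - x))) D x.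
Proof.
intros hs; destruct (rp_denominator_neg hs) as [delta [hd Hden]].
exists delta; split; [exact hd|]; intros a Da ha.
assert (hgea := rp_ge rp a Da); rewrite Rabs_pos_eq in ha by lra.
(* This radius keeps [x] within [delta] of [c]. *)
apply limit1_near with (delta - (a - c)); [lra|].
set (E := fun x => D_x D a x /\ Rabs (x - a) < delta - (a - c)).
set (u := fun x => h x - x).
set (den := fun x => g' x + b * ((u x + u a) / 2)).
assert (HE : forall x, E x -> D x /\ a <> x /\ den x <= g' c / 2).
{ intros x [[Dx hx] hxa]; repeat split; trivial.
  assert (hgex := rp_ge rp x Dx).
  apply Rabs_def2 in hxa.
  destruct (h_root x Dx) as [Hx _]; destruct (h_root a Da) as [Ha _].
  apply Hden; trivial; [rewrite Rabs_pos_eq; lra|].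
  unfold u; apply Rabs_def1; lra. }
assert (Hg : limit1_in (fun x => (g x - g a) / (x - a)) E (g' a) a).
{ refine (limit1_sub_ext _ _ _ _ _ _ _ (rp_g rp a Da)); intros x [Hx _]; auto. }
assert (Hg' : limit1_in (fun x => (g' x - g' a) / (x - a)) E (g'' a) a).
{ refine (limit1_sub_ext _ _ _ _ _ _ _ (rp_g' rp a Da)); intros x [Hx _]; auto. }
assert (Hnum := limit_plus _ _ _ _ _ _ Hg
  (limit_mul _ _ _ _ _ _ (limit1_const _ (u a) _) Hg')).
set (num := fun x => (g x - g a) / (x - a) + u a * ((g' x - g' a) / (x - a))) in Hnum.
assert (Hx : limit1_in (fun x => x - a) E 0 a).
{ apply limit1_eq with (a - a); [ring|].
  apply limit_minus; [apply lim_x | apply limit1_const]. }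
assert (Heq : forall x, E x -> u x - u a = - (num x * (x - a)) / den x).
{ intros x Ex; destruct (HE x Ex) as [Dx [hxa hdx]].
  assert (E1 := h_step_eq x Dx); assert (E2 := h_step_eq a Da).
  fold (u x) in E1; fold (u a) in E2.
  assert (E3 : num x * (x - a) = - ((u x - u a) * den x)).
  { unfold num.
    replace (((g x - g a) / (x - a) + u a * ((g' x - g' a) / (x - a))) * (x - a))
      with (g x - g a + u a * (g' x - g' a)) by (field; lra).
    unfold den; lra. }
  rewrite E3; field; lra. }
(* Continuity of [u] has to come first, from the uniform bound on [den] alone, because the limit of
   [den] depends on it. *)
assert (Hu : limit1_in u E (u a) a).
{ apply limit1_squeeze with (fun x => Rabs (num x * (x - a)) * (2 / - g' c)).
  - intros x Ex; destruct (HE x Ex) as [Dx [hxa hdx]].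
    rewrite (Heq x Ex); unfold Rdiv at 1; rewrite Rabs_mult, Rabs_Ropp.
    apply Rmult_le_compat_l; [apply Rabs_pos|].
    rewrite Rabs_inv, Rabs_left by lra.
    replace (2 / - g' c) with (/ (- g' c / 2)) by (field; lra).
    apply Rinv_le_contravar; lra.
  - apply limit1_eq with (0 * (2 / - g' c)); [ring|].
    apply limit_mul; [|apply limit1_const].
    assert (H := limit_mul _ _ _ _ _ _ Hnum Hx); rewrite Rmult_0_r in H.
    intros eps he; destruct (H eps he) as [alp [hal Hal]].
    exists alp; split; [exact hal|]; intros x hx; specialize (Hal x hx).
    simpl in *; unfold Rdist in *; rewrite Rminus_0_r in *; now rewrite Rabs_Rabsolu. }
assert (hda : g' a + b * u a < 0).
{ destruct (h_root a Da) as [Ha _].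
  assert (H := Hden a (u a) Da); unfold u in *.
  rewrite Rabs_pos_eq, Rabs_left1 in H by lra; lra. }
assert (Hdenlim : limit1_in den E (g' a + b * u a) a).
{ apply limit1_eq with (g' a + b * ((u a + u a) * / 2)); [field|].
  apply limit_plus.
  - refine (limit1_sub_ext _ _ _ _ _ _ _ (cont_deriv _ _ _ _ (rp_g' rp a Da))); intros x [Hx' _]; auto.
  - apply limit_mul; [apply limit1_const|].
    apply limit_mul; [|apply limit1_const].
    apply limit_plus; [exact Hu | apply limit1_const]. }
assert (H := limit_minus _ _ _ _ _ _ (limit1_const E 1 a)
  (limit_mul _ _ _ _ _ _ Hnum (limit_inv _ _ _ _ Hdenlim (Rlt_not_eq _ _ hda)))).
fold (u a); apply limit1_eq with (l' := u a * (b - g'' a) / (g' a + b * u a)) in H;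
  [|field; lra].
revert H; apply limit1_sub_ext; intros x Ex; split; [exact Ex|].
destruct (HE x Ex) as [Dx [hxa hdx]].
replace (h x - h a) with (u x - u a + (x - a)) by (unfold u; ring).
rewrite (Heq x Ex); field; lra.
Qed.

(** The derivative found above vanishes at [c]. Divided by [x - c] it is the product of the step
    ratio, of [b - g'' x] and of the inverse denominator; the witness is the product of their
    limits. *)
Lemma h_second_derivative_exists (x : R) :
  D x -> c < x -> continue_in g'' D c ->
  exists h2, second_derivative_at D h c h2.
Proof.
intros Dx hx Hcont; assert (hs := rp_slope x Dx hx).
assert (Dc := rp_root_in rp).
destruct (h_derivative hs) as [delta [hd Hh']].
exists (-1 * ((b - g'' c) * / (g' c + b * 0))).
exists (fun x => (h x - x) * (b - g'' x) / (g' x + b * (h x - x))), delta.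
repeat split; trivial.
assert (H := limit_mul _ _ _ _ _ _ h_step_ratio
  (limit_mul _ _ _ _ _ _
    (limit_minus _ _ _ _ _ _ (limit1_const _ b _) Hcont)
    (limit_inv _ _ _ _
      (limit_plus _ _ _ _ _ _ (cont_deriv _ _ _ _ (rp_g' rp c Dc))
        (limit_mul _ _ _ _ _ _ (limit1_const _ b _) h_step_lim0))
      ltac:(lra)))).
revert H; apply limit1_sub_ext; intros y [Dy hy]; repeat split; trivial.
rewrite h_fixes_root, Rminus_diag; unfold Rdiv; ring.
Qed.

(** * Convergence of the iterates and their rate *)

Lemma h_iterates_in (u : nat -> R) :
  D (u 0%nat) -> c < u 0%nat -> b <> g'' c -> (forall t, u (S t) = h (u t)) ->
  forall t, D (u t) /\ c < u t.
Proof.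
intros D0 h0 hb hu t; induction t as [|t [Dt ht]]; [easy|].
rewrite hu; assert (H := h_above_root (u t) Dt ht hb).
split; [apply (rp_between _ (u t) Dt)|]; lra.
Qed.

Lemma h_iterates_converge (u : nat -> R) :
  D (u 0%nat) -> c < u 0%nat -> b <> g'' c -> (forall t, u (S t) = h (u t)) ->
  Un_cv u c.
Proof.
intros D0 h0 hb hu; assert (Hin := h_iterates_in u D0 h0 hb hu).
assert (Hdec : forall t, u (S t) < u t).
{ intros t; destruct (Hin t) as [Dt ht]; rewrite hu; now apply h_above_root. }
assert (Hdec' : Un_decreasing u) by (intros t; left; apply Hdec).
destruct (decreasing_cv u Hdec') as [l Hl].
{ exists (- c); intros y [n ->]; destruct (Hin n); unfold opp_seq; lra. }
assert (hlow : forall t, l < u t).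
{ intros t; apply Rle_lt_trans with (2 := Hdec t).
  now apply decreasing_ineq. }
assert (hcl : c <= l).
{ apply Rle_cv_lim with (fun _ => c) u; [intros n; left; apply Hin | | exact Hl].
  intros eps he; exists 0%nat; intros n _; unfold Rdist.
  now rewrite Rminus_diag, Rabs_R0. }
assert (Dl : D l) by (apply (rp_between l (u 0%nat)); [easy|]; specialize (hlow 0%nat); lra).
(* Strict decrease keeps the iterates off their limit, as limits over [D_x] exclude the point
   itself. *)
assert (Hin' : forall t, D_x D l (u t)).
{ intros t; split; [apply Hin|]; specialize (hlow t); lra. }
assert (Hg := limit1_seq _ _ _ _ _ (cont_deriv _ _ _ _ (rp_g rp l Dl)) Hin' Hl).
assert (Hg' := limit1_seq _ _ _ _ _ (cont_deriv _ _ _ _ (rp_g' rp l Dl)) Hin' Hl).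
assert (Hstep : Un_cv (fun t => u (S t) - u t) (l - l)).
{ apply CV_minus; [|exact Hl].
  apply Un_cv_ext with (2 := CV_shift' u 1 l Hl); intros n; now rewrite Nat.add_1_r. }
rewrite Rminus_diag in Hstep.
assert (Hb : Un_cv (fun _ => b / 2) (b / 2)).
{ intros eps he; exists 0%nat; intros n _; unfold Rdist.
  now rewrite Rminus_diag, Rabs_R0. }
assert (H := CV_plus _ _ _ _ Hg (CV_mult _ _ _ _ Hstep
  (CV_plus _ _ _ _ Hg' (CV_mult _ _ _ _ Hb Hstep)))).
(* Passing to the limit in the step equation yields [g l = 0]. *)
assert (H0 : Un_cv (fun _ => 0) (g l + 0 * (g' l + b / 2 * 0))).
{ apply Un_cv_ext with (2 := H); intros n; rewrite hu; apply h_step_eq, Hin. }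
assert (E : g l + 0 * (g' l + b / 2 * 0) = 0).
{ apply UL_sequence with (1 := H0).
  intros eps he; exists 0%nat; intros n _; unfold Rdist.
  now rewrite Rminus_diag, Rabs_R0. }
destruct (Req_dec c l) as [->|hne]; [exact Hl|].
assert (hneg := rp_neg rp l Dl ltac:(lra)); lra.
Qed.

Lemma h_iterates_quadratic_rate (u : nat -> R) :
  D (u 0%nat) -> c < u 0%nat -> b <> g'' c -> (forall t, u (S t) = h (u t)) ->
  quadratic_rate u c (Rabs ((b - g'' c) / (2 * g' c))).
Proof.
intros D0 h0 hb hu; assert (Hin := h_iterates_in u D0 h0 hb hu).
assert (Hcv := h_iterates_converge u D0 h0 hb hu).
assert (Hin' : forall t, D_x D c (u t)) by (intros t; destruct (Hin t); split; [easy | lra]).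
repeat split; [exact Hcv | |].
- assert (H := cv_cvabs _ _ (limit1_seq _ _ _ _ _ h_quadratic_ratio Hin' Hcv)).
  rewrite Rabs_Ropp in H; revert H; apply Un_cv_ext; intros n.
  unfold Rdiv; now rewrite hu, Rabs_mult, Rabs_inv, RPow_abs.
- apply Rabs_pos_lt; unfold Rdiv; apply Rmult_integral_contrapositive; split; [lra|].
  apply Rinv_neq_0_compat; assert (hs := rp_simple rp); lra.
Qed.

End RightProblem.

(** * The two-sided problem and its reflection *)

Record us_problem (Theta : R -> Prop) (g g' g'' : R -> R) (c b21 b22 : R) : Prop := {
  us_interval : is_interval Theta;
  us_g : derivative_on Theta g g';
  us_g' : derivative_on Theta g' g'';
  us_root_in : Theta c;
  us_root : g c = 0;
  us_pos : forall x, Theta x -> x < c -> g x > 0;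
  us_neg : forall x, Theta x -> x > c -> g x < 0;
  us_slub : forall x, Theta x -> b21 <= g'' x <= b22;
  us_simple : g' c <> 0 }.

Arguments us_interval {_ _ _ _ _ _ _} _.
Arguments us_root_in {_ _ _ _ _ _ _} _.

(** Argument and value are both negated, which preserves the sign pattern of [g] around the root.
    The second derivative changes sign, so the two bounds are negated and exchanged. *)
Lemma us_problem_opp (Theta : R -> Prop) (g g' g'' : R -> R) (c b21 b22 : R) :
  us_problem Theta g g' g'' c b21 b22 ->
  us_problem (fun t => Theta (- t)) (fun t => - g (- t)) (fun t => g' (- t))
    (fun t => - g'' (- t)) (- c) (- b22) (- b21).
Proof.
intros [hI Hg Hg' Hc Hr Hp Hn Hs H0]; split; try rewrite Ropp_involutive; trivial.
- intros x y z Dx Dz h; apply (hI (- z) (- y) (- x)); trivial; lra.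
- intros x Dx; now apply D_in_opp_arg, Hg.
- intros x Dx; assert (H := Dopp _ _ _ _ (D_in_opp_arg _ _ _ _ (Hg' _ Dx))).
  revert H; apply limit1_sub_ext; intros y Hy; split; [exact Hy|].
  now rewrite !Ropp_involutive.
- lra.
- intros x Dx hx; assert (H := Hn (- x) Dx ltac:(lra)); lra.
- intros x Dx hx; assert (H := Hp (- x) Dx ltac:(lra)); lra.
- intros x Dx; specialize (Hs (- x) Dx); lra.
Qed.

Lemma U_left (g g' : R -> R) (b21 b22 y x : R) :
  y <= x -> U g g' b21 b22 y x = quad g g' b22 y x.
Proof.
intros h; unfold U, quad, b2, indicator.
destruct (Rle_dec y x), (Rgt_dec y x); lra.
Qed.

(** The case [y = x] belongs to the other branch of [b2], but the quadratic term vanishes there. *)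
Lemma U_right (g g' : R -> R) (b21 b22 y x : R) :
  x <= y -> U g g' b21 b22 y x = quad g g' b21 y x.
Proof.
intros h; destruct (Req_dec x y) as [->|hne].
- rewrite U_left, !quad_diag; lra.
- unfold U, quad, b2, indicator.
  destruct (Rle_dec y x), (Rgt_dec y x); lra.
Qed.

Lemma U_opp (g g' : R -> R) (b21 b22 y x : R) :
  U (fun t => - g (- t)) (fun t => g' (- t)) (- b22) (- b21) (- y) (- x)
    = - U g g' b21 b22 y x.
Proof.
destruct (Rle_dec y x) as [h|h].
- rewrite U_right, U_left by lra; unfold quad; rewrite Ropp_involutive; field.
- rewrite U_left, U_right by lra; unfold quad; rewrite Ropp_involutive; field.
Qed.

Lemma us_right_problem (Theta : R -> Prop) (g g' g'' : R -> R) (c b21 b22 : R) :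
  us_problem Theta g g' g'' c b21 b22 ->
  right_problem (right_part Theta c) g g' g'' c b22.
Proof.
intros [hI Hg Hg' Hc Hr Hp Hn Hs H0]; split; trivial.
- intros x y z [Dx hx] [Dz hz] h; split; [now apply (hI x y z) | lra].
- split; [exact Hc | lra].
- now intros x [_ hx].
- intros x [Dx hx]; apply D_in_incl with Theta; [now intros y []|]; now apply Hg.
- intros x [Dx hx]; apply D_in_incl with Theta; [now intros y []|]; now apply Hg'.
- intros x [Dx _] hx; now apply Hn.
- intros x [Dx _]; now apply Hs.
Qed.

(** To the left of [x], [U] majorizes [g], which is positive before [c]; to the right of [x], by
    reflection, [U] minorizes [g], which is negative there. Neither region can contain a zero of
    [U]. *)
Lemma us_root_of_U_located (Theta : R -> Prop) (g g' g'' : R -> R) (c b21 b22 x y : R) :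
  us_problem Theta g g' g'' c b21 b22 -> Theta x -> c <= x -> Theta y ->
  U g g' b21 b22 y x = 0 -> c <= y <= x /\ quad g g' b22 y x = 0.
Proof.
intros Hus Dx hx Dy E; destruct (Hus) as [hI Hg Hg' Hc Hr Hp Hn Hs H0].
destruct (Rle_dec y x) as [hyx|hyx].
- rewrite U_left in E by exact hyx; repeat split; trivial.
  destruct (Rle_dec c y) as [h|h]; [exact h|exfalso].
  assert (H := quad_majorizes Theta g g' g'' b22 y x hI Hg Hg'
    (fun t Dt => proj2 (Hs t Dt)) Dy Dx hyx).
  assert (H1 := Hp y Dy ltac:(lra)); lra.
- exfalso; assert (Hopp := us_problem_opp _ _ _ _ _ _ _ Hus).
  destruct Hopp as [hI' Hg1 Hg1' _ _ _ _ Hs' _].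
  assert (Dx' : Theta (- - x)) by (now rewrite Ropp_involutive).
  assert (Dy' : Theta (- - y)) by (now rewrite Ropp_involutive).
  assert (H := quad_majorizes _ _ _ _ (- b21) (- y) (- x) hI' Hg1 Hg1'
    (fun t Dt => proj2 (Hs' t Dt)) Dy' Dx' ltac:(lra)).
  rewrite <- (U_left _ _ (- b22)), U_opp, E in H by lra.
  rewrite Ropp_involutive in H.
  assert (H1 := Hn y Dy ltac:(lra)); lra.
Qed.

(** Uniqueness on [[c, x]] extends to [Theta] because all roots of [U] in [Theta] lie in that
    segment. *)
Lemma us_map_exists_right (Theta : R -> Prop) (g g' g'' : R -> R) (c b21 b22 x : R) :
  us_problem Theta g g' g'' c b21 b22 -> Theta x -> c <= x ->
  exists! y, Theta y /\ U g g' b21 b22 y x = 0.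
Proof.
intros Hus Dx hx; assert (Hrp := us_right_problem _ _ _ _ _ _ _ Hus).
destruct (rp_quad_unique_root _ _ _ _ _ _ Hrp x (conj Dx hx)) as [y [hy [Ey Huniq]]].
exists y; split; [split|].
- apply (us_interval Hus c y x); trivial; apply Hus.
- now rewrite U_left.
- intros z [Dz Ez]; symmetry.
  destruct (us_root_of_U_located _ _ _ _ _ _ _ x z Hus Dx hx Dz Ez); auto.
Qed.

Lemma us_right_half (Theta : R -> Prop) (g g' g'' : R -> R) (c b21 b22 : R)
    (h : R -> R) (theta : nat -> R) :
  us_problem Theta g g' g'' c b21 b22 ->
  US_map Theta g g' b21 b22 h -> Theta (theta 0%nat) ->
  (forall t, theta (S t) = h (theta t)) -> c < theta 0%nat -> b22 <> g'' c ->
  quadratic_rate theta c (Rabs ((b22 - g'' c) / (2 * g' c))) /\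
  (forall h2, second_derivative_at (right_part Theta c) h c h2 ->
    Rabs h2 / 2 = Rabs ((b22 - g'' c) / (2 * g' c))) /\
  (continue_in g'' (right_part Theta c) c ->
    exists h2, second_derivative_at (right_part Theta c) h c h2).
Proof.
intros Hus Hh D0 Hstep h0 hb; assert (Hrp := us_right_problem _ _ _ _ _ _ _ Hus).
assert (Hroot : forall x, right_part Theta c x ->
  c <= h x <= x /\ quad g g' b22 (h x) x = 0).
{ intros x [Dx hx]; destruct (Hh x Dx) as [Dhx E].
  exact (us_root_of_U_located _ _ _ _ _ _ _ x (h x) Hus Dx hx Dhx E). }
assert (D0' : right_part Theta c (theta 0%nat)) by (split; [exact D0 | lra]).
split; [|split].
- now apply (h_iterates_quadratic_rate _ _ _ _ _ _ Hrp h Hroot).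
- intros h2 Hh2.
  assert (E := h_second_derivative_value _ _ _ _ _ _ Hrp h Hroot _ h2 D0' h0 Hh2).
  rewrite <- (Rabs_Ropp ((b22 - g'' c) / _)), <- E; unfold Rdiv.
  rewrite Rabs_mult, (Rabs_pos_eq (/ 2)); lra.
- exact (h_second_derivative_exists _ _ _ _ _ _ Hrp h Hroot _ D0' h0).
Qed.

Lemma quadratic_rate_opp (u : nat -> R) (l C : R) :
  quadratic_rate (fun t => - u t) (- l) C -> quadratic_rate u l C.
Proof.
assert (E : forall x, Rabs (- x - - l) = Rabs (x - l)).
{ intros x; rewrite <- Rabs_Ropp; f_equal; ring. }
intros [Hl [HC hC]]; repeat split; trivial.
- intros eps he; destruct (Hl eps he) as [N HN]; exists N; intros n hn.
  specialize (HN n hn); unfold Rdist in *; now rewrite E in HN.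
- revert HC; apply Un_cv_ext; intros n; now rewrite !E.
Qed.

(** The domains and functions are related only pointwise, so that the lemma serves both to pass to
    the reflected problem and to come back. *)
Lemma second_derivative_at_opp (D D' : R -> Prop) (f f1 : R -> R) (x l : R) :
  D' x -> (forall t, D' t -> D (- t) /\ f1 t = - f (- t)) ->
  second_derivative_at D f (- x) l -> second_derivative_at D' f1 x (- l).
Proof.
intros D'x H [f' [delta [hd [Hf' Hl]]]].
exists (fun t => f' (- t)), delta; repeat split; trivial.
- intros y D'y hy; destruct (H y D'y) as [Dy Ey].
  assert (Hy : Rabs (- y - - x) < delta).
  { rewrite <- Rabs_Ropp; now replace (- (- y - - x)) with (y - x) by ring. }
  assert (H1 := D_in_opp_arg _ _ _ _ (Hf' (- y) Dy Hy)).
  revert H1; apply limit1_sub_ext; intros z [Dz hz]; destruct (H z Dz) as [Dz' Ez].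
  repeat split; trivial; now rewrite Ey, Ez.
- assert (H1 := Dopp _ _ _ _ (D_in_opp_arg _ _ _ _ Hl)).
  revert H1; apply limit1_sub_ext; intros z [Dz hz]; destruct (H z Dz) as [Dz' Ez].
  repeat split; trivial; now rewrite !Ropp_involutive.
Qed.

(** The right half is applied to the map [fun t => - h (- t)] and the iterates [- theta t], with
    [- b21] as upper bound. *)
Lemma us_left_half (Theta : R -> Prop) (g g' g'' : R -> R) (c b21 b22 : R)
    (h : R -> R) (theta : nat -> R) :
  us_problem Theta g g' g'' c b21 b22 ->
  US_map Theta g g' b21 b22 h -> Theta (theta 0%nat) ->
  (forall t, theta (S t) = h (theta t)) -> theta 0%nat < c -> b21 <> g'' c ->
  quadratic_rate theta c (Rabs ((b21 - g'' c) / (2 * g' c))) /\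
  (forall h2, second_derivative_at (left_part Theta c) h c h2 ->
    Rabs h2 / 2 = Rabs ((b21 - g'' c) / (2 * g' c))) /\
  (continue_in g'' (left_part Theta c) c ->
    exists h2, second_derivative_at (left_part Theta c) h c h2).
Proof.
intros Hus Hh D0 Hstep h0 hb.
assert (Hus' := us_problem_opp _ _ _ _ _ _ _ Hus).
assert (Hh' : US_map (fun t => Theta (- t)) (fun t => - g (- t)) (fun t => g' (- t))
  (- b22) (- b21) (fun t => - h (- t))).
{ intros x Dx; destruct (Hh (- x) Dx) as [Dhx E]; rewrite Ropp_involutive.
  split; [exact Dhx|].
  assert (E' := U_opp g g' b21 b22 (h (- x)) (- x)).
  rewrite Ropp_involutive in E'; lra. }
destruct (us_right_half _ _ _ _ _ _ _ _ (fun t => - theta t) Hus' Hh') as [H1 [H2 H3]].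
- now rewrite Ropp_involutive.
- intros t; rewrite Ropp_involutive; now rewrite Hstep.
- lra.
- rewrite Ropp_involutive; lra.
- rewrite Ropp_involutive in H1, H2.
  assert (EC : Rabs ((- b21 - - g'' c) / (2 * g' c)) = Rabs ((b21 - g'' c) / (2 * g' c))).
  { rewrite <- Rabs_Ropp; f_equal; unfold Rdiv; ring. }
  rewrite EC in H1, H2.
  assert (Dc := us_root_in Hus).
  split; [|split].
  + now apply quadratic_rate_opp.
  + intros h2 Hh2; rewrite <- Rabs_Ropp; apply H2.
    apply second_derivative_at_opp with (left_part Theta c) h.
    * rewrite <- (Ropp_involutive c) in Dc; split; [exact Dc | lra].
    * intros t [Dt ht]; repeat split; trivial; lra.
    * now rewrite Ropp_involutive.
  + intros Hcont; destruct H3 as [h2 Hh2].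
    * assert (H4 : limit1_in g'' (D_x (left_part Theta c) c) (g'' c) (- - c))
        by (rewrite Ropp_involutive; exact Hcont).
      apply limit1_opp_arg, limit_Ropp in H4.
      unfold continue_in; rewrite Ropp_involutive.
      revert H4; apply limit1_sub_ext; intros t [[Dt ht] hne].
      repeat split; trivial; lra.
    * exists (- h2); revert Hh2; apply second_derivative_at_opp.
      -- split; [exact Dc | lra].
      -- intros t [Dt ht]; rewrite <- (Ropp_involutive t) in Dt.
         repeat split; trivial; [lra|]; now rewrite !Ropp_involutive.
Qed.

Theorem theorem3
  (Theta : R -> Prop) (g g' g'' : R -> R) (theta_star b21 b22 : R)
  (hTheta : is_interval Theta)
  (hg' : derivative_on Theta g g')
  (hg'' : derivative_on Theta g' g'')
  (hstar : Theta theta_star)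
  (hroot : forall x, Theta x -> (g x = 0 <-> x = theta_star))
  (hpos : forall x, Theta x -> x < theta_star -> g x > 0)
  (hneg : forall x, Theta x -> x > theta_star -> g x < 0)
  (hslub : forall x, Theta x -> b21 <= g'' x <= b22)
  (hsimple : g' theta_star <> 0) :
  (forall x, Theta x -> exists! y, Theta y /\ U g g' b21 b22 y x = 0) /\
  (forall (h : R -> R) (theta : nat -> R),
    US_map Theta g g' b21 b22 h ->
    Theta (theta 0%nat) ->
    (forall t, theta (S t) = h (theta t)) ->
    (theta_star < theta 0%nat -> b22 <> g'' theta_star ->
      quadratic_rate theta theta_star
        (Rabs ((b22 - g'' theta_star) / (2 * g' theta_star))) /\
      (forall h2, second_derivative_at (right_part Theta theta_star) h theta_star h2 ->
        Rabs h2 / 2 = Rabs ((b22 - g'' theta_star) / (2 * g' theta_star))) /\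
      (continue_in g'' (right_part Theta theta_star) theta_star ->
        exists h2, second_derivative_at (right_part Theta theta_star) h theta_star h2)) /\
    (theta 0%nat < theta_star -> b21 <> g'' theta_star ->
      quadratic_rate theta theta_star
        (Rabs ((b21 - g'' theta_star) / (2 * g' theta_star))) /\
      (forall h2, second_derivative_at (left_part Theta theta_star) h theta_star h2 ->
        Rabs h2 / 2 = Rabs ((b21 - g'' theta_star) / (2 * g' theta_star))) /\
      (continue_in g'' (left_part Theta theta_star) theta_star ->
        exists h2, second_derivative_at (left_part Theta theta_star) h theta_star h2))).
Proof.
assert (Hus : us_problem Theta g g' g'' theta_star b21 b22).
{ split; trivial; now apply hroot. }
split.
- intros x Dx; destruct (Rle_dec theta_star x) as [hx|hx].
  + exact (us_map_exists_right _ _ _ _ _ _ _ x Hus Dx hx).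
  + assert (Dx' : Theta (- - x)) by (now rewrite Ropp_involutive).
    destruct (us_map_exists_right _ _ _ _ _ _ _ (- x) (us_problem_opp _ _ _ _ _ _ _ Hus)
      Dx' ltac:(lra)) as [y [[Dy Ey] Huniq]].
    (* The root for [x] is the opposite of the root of the reflected problem at [- x]. *)
    exists (- y); split; [split; [exact Dy|]|].
    * rewrite <- (Ropp_involutive y), U_opp in Ey; lra.
    * intros z [Dz Ez]; rewrite (Huniq (- z)); [ring|].
      rewrite U_opp, Ez, Ropp_involutive; split; [exact Dz | ring].
- intros h theta Hh D0 Hstep; split; intros h0 hb.
  + exact (us_right_half _ _ _ _ _ _ _ _ _ Hus Hh D0 Hstep h0 hb).
  + exact (us_left_half _ _ _ _ _ _ _ _ _ Hus Hh D0 Hstep h0 hb).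
Qed.
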